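(* Let $A\in\mathbb{H}^{m\times n}$. Then: (a) $\big(\mathcal{N}_l(A)_l^{\perp}\big)_l^{\perp}=\mathcal{N}_l(A)$ and $\big(\mathcal{N}_r(A)_r^{\perp}\big)_r^{\perp}=\mathcal{N}_r(A)$. (b) $\big(\mathcal{R}_l(A)_l^{\perp}\big)_l^{\perp}=\mathcal{R}_l(A)$ and $\big(\mathcal{R}_r(A)_r^{\perp}\big)_r^{\perp}=\mathcal{R}_r(A)$. (c) $\mathcal{N}_l(A)=\mathcal{R}_l(A^* )_l^{\perp}$. (d) $\mathcal{N}_r(A)=\mathcal{R}_r(A^* )_r^{\perp}$.
   Context: $\mathbb{H}$ denotes the real quaternions; $A^*$ is the conjugate transpose. For $B\in\mathbb{H}^{m\times n}$: $\mathcal{R}_r(B)=\{Bx : x\in\mathbb{H}^{n\times 1}\}$, $\mathcal{N}_r(B)=\{x\in\mathbb{H}^{n\times 1} : Bx=0\}$, $\mathcal{R}_l(B)=\{xB : x\in\mathbb{H}^{1\times m}\}$, $\mathcal{N}_l(B)=\{x\in\mathbb{H}^{1\times m} : xB=0\}$. On the left quaternion vector space $\mathbb{H}^{1\times n}$ the inner product is $\langle x,y\rangle_l=xy^*=\sum_i x_i\bar y_i$, and on the right quaternion vector space $\mathbb{H}^{n\times 1}$ it is $\langle x,y\rangle_r=y^*x=\sum_j\bar y_jx_j$. For $\mathcal{V}\subseteq\mathbb{H}^{1\times n}$, $\mathcal{V}_l^\perp=\{x\in\mathbb{H}^{1\times n} : \langle x,y\rangle_l=0\ \text{for all } y\in\mathcal{V}\}$;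 for $\mathcal{U}\subseteq\mathbb{H}^{n\times 1}$, $\mathcal{U}_r^\perp=\{x\in\mathbb{H}^{n\times 1} : \langle x,y\rangle_r=0\ \text{for all } y\in\mathcal{U}\}$. *)

(* Defs.v *)
From HB Require Import structures.
From mathcomp Require Import all_boot all_order all_algebra.
From mathcomp Require Import ring.
From mathcomp Require Import classical_sets reals.

Set Implicit Arguments.
Unset Strict Implicit.
Unset Printing Implicit Defensive.

Import GRing.Theory.
Local Open Scope ring_scope.
Local Open Scope classical_set_scope.

(* Quat a b c d stands for a + b i + c j + d k. *)
Record quat (R : Type) := Quat {
  qre : R;
  qi : R;
  qj : R;
  qk : R
}.

Section QuatType.
Variable R : Type.

Definition prod_of_quat (x : quat R) : R * R * R * R :=
  (qre x, qi x, qj x, qk x).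

Definition quat_of_prod (p : R * R * R * R) : quat R :=
  let: (a, b, c, d) := p in Quat a b c d.

Lemma prod_of_quatK : cancel prod_of_quat quat_of_prod.
Proof. by case. Qed.

End QuatType.

HB.instance Definition _ (R : choiceType) :=
  Choice.copy (quat R) (can_type (@prod_of_quatK R)).

Section QuatRing.
Variable R : comNzRingType.
Implicit Types x y z : quat R.

Definition quat0 : quat R := Quat 0 0 0 0.
Definition quat1 : quat R := Quat 1 0 0 0.

Definition addq x y : quat R :=
  Quat (qre x + qre y) (qi x + qi y) (qj x + qj y) (qk x + qk y).

Definition oppq x : quat R := Quat (- qre x) (- qi x) (- qj x) (- qk x).

(* Hamilton product: i^2 = j^2 = k^2 = ijk = -1. *)
Definition mulq x y : quat R :=
  let: Quat a b c d := x in
  let: Quat a' b' c' d' := y in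
  Quat (a * a' - b * b' - c * c' - d * d')
       (a * b' + b * a' + c * d' - d * c')
       (a * c' - b * d' + c * a' + d * b')
       (a * d' + b * c' - c * b' + d * a').

Lemma addqA : associative addq.
Proof. by case=> [????] [????] [????]; rewrite /addq /= !addrA. Qed.

Lemma addqC : commutative addq.
Proof. by case=> [????] [????]; rewrite /addq /=; congr Quat; apply: addrC. Qed.

Lemma add0q : left_id quat0 addq.
Proof. by case=> [????]; rewrite /addq /= !add0r. Qed.

Lemma addNq : left_inverse quat0 oppq addq.
Proof. by case=> [????]; rewrite /addq /= !addNr. Qed.

Lemma mulqA : associative mulq.
Proof. by case=> [????] [????] [????] /=; congr Quat; ring. Qed.

Lemma mul1q : left_id quat1 mulq.
Proof. by case=> [????] /=; congr Quat; ring. Qed.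

Lemma mulq1 : right_id quat1 mulq.
Proof. by case=> [????] /=; congr Quat; ring. Qed.

Lemma mulqDl : left_distributive mulq addq.
Proof. by case=> [????] [????] [????]; rewrite /addq /=; congr Quat; ring. Qed.

Lemma mulqDr : right_distributive mulq addq.
Proof. by case=> [????] [????] [????]; rewrite /addq /=; congr Quat; ring. Qed.

Lemma quat1_neq0 : quat1 != quat0.
Proof. by apply/eqP => -[] /eqP; rewrite oner_eq0. Qed.

HB.instance Definition _ := GRing.isZmodule.Build (quat R)
  addqA addqC add0q addNq.

HB.instance Definition _ := GRing.Zmodule_isNzRing.Build (quat R)
  mulqA mul1q mulq1 mulqDl mulqDr quat1_neq0.

Definition qconj x : quat R := Quat (qre x) (- qi x) (- qj x) (- qk x).

End QuatRing.

Section QuatMatrix.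
Variable R : realType.
Local Notation H := (quat R).

Definition adjmx m n (A : 'M[H]_(m, n)) : 'M[H]_(n, m) := (map_mx (@qconj R) A)^T.

Definition range_r m n (B : 'M[H]_(m, n)) : set 'cV[H]_m :=
  [set y | exists x : 'cV[H]_n, y = B *m x].

Definition null_r m n (B : 'M[H]_(m, n)) : set 'cV[H]_n :=
  [set x | B *m x = 0].

Definition range_l m n (B : 'M[H]_(m, n)) : set 'rV[H]_n :=
  [set y | exists x : 'rV[H]_m, y = x *m B].

Definition null_l m n (B : 'M[H]_(m, n)) : set 'rV[H]_m :=
  [set x | x *m B = 0].

Definition inner_l n (x y : 'rV[H]_n) : H := \sum_i x 0 i * qconj (y 0 i).

Definition inner_r n (x y : 'cV[H]_n) : H := \sum_j qconj (y j 0) * x j 0.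

Definition orth_l n (V : set 'rV[H]_n) : set 'rV[H]_n :=
  [set x | forall y, V y -> inner_l x y = 0].

Definition orth_r n (U : set 'cV[H]_n) : set 'cV[H]_n :=
  [set x | forall y, U y -> inner_r x y = 0].

End QuatMatrix.

(* Main.v *)
Require Import Defs.
From mathcomp Require Import all_boot all_order all_algebra.
From mathcomp Require Import ring.
From mathcomp Require Import classical_sets reals.

(** Over a division ring every matrix [B] has an inner inverse [G], i.e.
  [B G B = B]. The columns of [1 - G B] are killed by [B], so their conjugate
  transposes are orthogonal to the left row space of [B]; hence a row [x] in the
  double orthogonal complement satisfies [x (1 - G B) = 0], that is
  [x = (x G) B]. The right-handed case uses [1 - B G]. Null spaces are
  orthogonal complements of ranges, and a triple complement is a single one. *)

Import GRing.Theory Num.Theory.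
Local Open Scope ring_scope.
Local Open Scope classical_set_scope.

(* McCoy's lemma: regularity of [B - B X B] implies regularity of [B]. *)
Lemma inner_inverse_sub {D : pzRingType} {m n : nat} (B : 'M[D]_(m, n))
    (X Y : 'M[D]_(n, m)) (C := B - B *m X *m B) :
  C *m Y *m C = C -> exists G : 'M[D]_(n, m), B *m G *m B = B.
Proof.
(* With [L = 1 - X B] and [N = 1 - B X], both [B L] and [N B] equal [C], so [B (X + L Y N) B = B X B
   + C Y C = B X B + C = B]. *)
move=> CYC; exists (X + (1%:M - X *m B) *m Y *m (1%:M - B *m X)).
have CL : B *m (1%:M - X *m B) = C by rewrite mulmxBr mulmx1 mulmxA.
have CR : (1%:M - B *m X) *m B = C by rewrite mulmxBl mul1mx.
move: (1%:M - X *m B) (1%:M - B *m X) CL CR => L N CL CR.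
rewrite mulmxDr mulmxDl 2!mulmxA CL -[C *m Y *m N *m B]mulmxA CR CYC.
by rewrite addrC subrK.
Qed.

(** If some entry of [r] is nonzero, its right inverse, placed at the same index of a zero column,
    gives [r c = 1]. *)
Lemma inner_inverse_row {D : nzRingType} {n : nat} (r : 'rV[D]_n) :
  (forall x : D, x != 0 -> exists y, x * y = 1) ->
  exists c : 'cV[D]_n, r *m c *m r = r.
Proof.
move=> invD; have [->|/rV0Pn[j rj0]] := eqVneq r 0.
  by exists 0; rewrite mulmx0.
have [y rjy] := invD _ rj0; exists (\col_i (if i == j then y else 0)).
suff -> : r *m (\col_i (if i == j then y else 0)) = 1%:M by rewrite mul1mx.
apply/matrixP => i k; rewrite !ord1 !mxE (bigD1 j) //= mxE eqxx rjy.
by rewrite big1 ?addr0// => l /negbTE lj; rewrite mxE lj mulr0.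
Qed.

(** Induction on the number of rows: one elimination step clears the top row, and McCoy's lemma
    lifts an inner inverse back from the remaining block. *)
Lemma inner_inverse_exists {D : nzRingType} {m n : nat} (B : 'M[D]_(m, n)) :
  (forall x : D, x != 0 -> exists y, x * y = 1) ->
  exists G : 'M[D]_(n, m), B *m G *m B = B.
Proof.
move=> invD; elim: m B => [|m IHm] B.
  by exists 0; apply/matrixP => -[].
rewrite -[m.+1]/(1 + m)%N in B *.
rewrite -[B]vsubmxK; move: (usubmx B) (dsubmx B) => r B'.
have [c rcr] := inner_inverse_row r invD.
have [Y BYB] := IHm (B' - B' *m c *m r).
(* Since [r c r = r], this first witness makes the top row of [B - B X B] vanish; the second then
   only has to invert the lower block. *)
apply: (inner_inverse_sub _ (row_mx c 0) (row_mx 0 Y)).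
have -> : col_mx r B' - col_mx r B' *m row_mx c 0 *m col_mx r B' =
          col_mx 0 (B' - B' *m c *m r).
  rewrite -mulmxA mul_row_col mul0mx addr0 mul_col_mx opp_col_mx add_col_mx.
  by rewrite !mulmxA rcr subrr.
by rewrite -mulmxA mul_row_col mul0mx add0r mul_col_mx mul0mx mulmxA BYB.
Qed.

Section Quaternions.
Variable R : realType.
Local Notation H := (quat R).

Lemma quat_rinv (x : H) : x != 0 -> exists y, x * y = 1.
Proof.
case: x => a b c d x0; pose N := a ^+ 2 + b ^+ 2 + c ^+ 2 + d ^+ 2.
have N0 : N != 0.
  apply: contraNneq x0 => /eqP.
  rewrite !paddr_eq0 ?addr_ge0 ?sqr_ge0// !sqrf_eq0.
  by move=> /andP[/andP[/andP[/eqP-> /eqP->] /eqP->] /eqP->].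
(* The conjugate divided by the squared norm. *)
exists (Quat (a / N) (- b / N) (- c / N) (- d / N)).
by congr Quat; rewrite /N; field.
Qed.

Lemma qconjK : involutive (@qconj R).
Proof. by case=> a b c d; rewrite /qconj /= !opprK. Qed.

Lemma qconjM (x y : H) : qconj (x * y) = qconj y * qconj x.
Proof. by case: x y => [????] [????]; congr Quat => /=; ring. Qed.

Lemma qconj0 : qconj (0 : H) = 0.
Proof. by congr Quat; rewrite /= ?oppr0. Qed.

Lemma qconjD (x y : H) : qconj (x + y) = qconj x + qconj y.
Proof. by congr Quat; rewrite /= ?opprD. Qed.

Lemma adjmxK {m n : nat} (A : 'M[H]_(m, n)) : adjmx (adjmx A) = A.
Proof. by apply/matrixP => i j; rewrite !mxE qconjK. Qed.

Lemma adjmx0 (m n : nat) : adjmx (0 : 'M[H]_(m, n)) = 0.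
Proof. by apply/matrixP => i j; rewrite !mxE qconj0. Qed.

Lemma adjmxM {m n p : nat} (A : 'M[H]_(m, n)) (B : 'M[H]_(n, p)) :
  adjmx (A *m B) = adjmx B *m adjmx A.
Proof.
apply/matrixP => i j; rewrite !mxE (big_morph _ qconjD qconj0).
by apply: eq_bigr => k _; rewrite !mxE qconjM.
Qed.

(** Turns orthogonality into a matrix equation, so that associativity and the rules for [adjmx]
    apply. *)
Lemma inner_l_eq0 {n : nat} (x y : 'rV[H]_n) :
  inner_l x y = 0 <-> x *m adjmx y = 0.
Proof.
have -> : inner_l x y = (x *m adjmx y) 0 0.
  by rewrite mxE; apply: eq_bigr => i _; rewrite !mxE.
by split=> [xy0|->]; [apply/matrixP => i j; rewrite !ord1 xy0|]; rewrite mxE.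
Qed.

Lemma inner_r_eq0 {n : nat} (x y : 'cV[H]_n) :
  inner_r x y = 0 <-> adjmx y *m x = 0.
Proof.
have -> : inner_r x y = (adjmx y *m x) 0 0.
  by rewrite mxE; apply: eq_bigr => i _; rewrite !mxE.
by split=> [xy0|->]; [apply/matrixP => i j; rewrite !ord1 xy0|]; rewrite mxE.
Qed.

Lemma inner_l_sym0 {n : nat} (x y : 'rV[H]_n) :
  inner_l x y = 0 -> inner_l y x = 0.
Proof.
move=> /inner_l_eq0/(congr1 (@adjmx _ _ _)) xy0; apply/inner_l_eq0.
by rewrite adjmxM adjmxK adjmx0 in xy0.
Qed.

Lemma inner_r_sym0 {n : nat} (x y : 'cV[H]_n) :
  inner_r x y = 0 -> inner_r y x = 0.
Proof.
move=> /inner_r_eq0/(congr1 (@adjmx _ _ _)) xy0; apply/inner_r_eq0.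
by rewrite adjmxM adjmxK adjmx0 in xy0.
Qed.

(** Formal consequence of the symmetry of orthogonality, which puts every set inside its double
    complement. *)
Lemma orth_lK3 {n : nat} (V : set 'rV[H]_n) :
  orth_l (orth_l (orth_l V)) = orth_l V.
Proof.
apply/seteqP; split=> x xV y yV.
  by apply: xV => z zV; apply: inner_l_sym0; exact: zV.
by apply: inner_l_sym0; exact: yV.
Qed.

Lemma orth_rK3 {n : nat} (V : set 'cV[H]_n) :
  orth_r (orth_r (orth_r V)) = orth_r V.
Proof.
apply/seteqP; split=> x xV y yV.
  by apply: xV => z zV; apply: inner_r_sym0; exact: zV.
by apply: inner_r_sym0; exact: yV.
Qed.

Lemma null_l_orth {m n : nat} (A : 'M[H]_(m, n)) :
  null_l A = orth_l (range_l (adjmx A)).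
Proof.
apply/seteqP; split=> x xA.
  move=> _ [y ->]; apply/inner_l_eq0.
  by rewrite adjmxM adjmxK mulmxA xA mul0mx.
(* Orthogonality is tested on the rows of [adjmx A], the adjoints of the columns of [A]. *)
have xAe j : x *m (A *m delta_mx j 0 : 'cV_m) = 0.
  rewrite -[A *m _]adjmxK; apply/inner_l_eq0/xA.
  by rewrite adjmxM; eexists.
apply/rowP => j; have /matrixP/(_ 0 0) := xAe j.
by rewrite mulmxA -colE !mxE.
Qed.

Lemma null_r_orth {m n : nat} (A : 'M[H]_(m, n)) :
  null_r A = orth_r (range_r (adjmx A)).
Proof.
apply/seteqP; split=> x xA.
  move=> _ [y ->]; apply/inner_r_eq0.
  by rewrite adjmxM adjmxK -mulmxA xA mulmx0.
have xAe i : (delta_mx 0 i *m A : 'rV_n) *m x = 0.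
  rewrite -[_ *m A]adjmxK; apply/inner_r_eq0/xA.
  by rewrite adjmxM; eexists.
apply/colP => i; have /matrixP/(_ 0 0) := xAe i.
by rewrite -mulmxA -rowE !mxE.
Qed.

Lemma range_l_orthK {m n : nat} (A : 'M[H]_(m, n)) :
  orth_l (orth_l (range_l A)) = range_l A.
Proof.
apply/seteqP; split=> x xA; last first.
  by move=> y yA; apply/inner_l_sym0/yA.
have [G AGA] := inner_inverse_exists A quat_rinv.
(* The inner complement becomes the left null space of [adjmx A], where membership is an
   equation. *)
rewrite -(adjmxK A) -null_l_orth in xA.
suff /eqP : x *m (1%:M - G *m A) = 0.
  by rewrite mulmxBr mulmx1 subr_eq0 mulmxA => /eqP ->; eexists.
have AG : A *m (1%:M - G *m A) = 0 by rewrite mulmxBr mulmx1 mulmxA AGA subrr.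
suff xe j : x *m col j (1%:M - G *m A) = 0.
  apply/rowP => j; have /matrixP/(_ 0 0) := xe j.
  by rewrite colE mulmxA -colE !mxE.
rewrite -[col j _]adjmxK; apply/inner_l_eq0/xA.
by rewrite /null_l /= -adjmxM colE mulmxA AG mul0mx adjmx0.
Qed.

Lemma range_r_orthK {m n : nat} (A : 'M[H]_(m, n)) :
  orth_r (orth_r (range_r A)) = range_r A.
Proof.
apply/seteqP; split=> x xA; last first.
  by move=> y yA; apply/inner_r_sym0/yA.
have [G AGA] := inner_inverse_exists A quat_rinv.
rewrite -(adjmxK A) -null_r_orth in xA.
suff /eqP : (1%:M - A *m G) *m x = 0.
  by rewrite mulmxBl mul1mx subr_eq0 -mulmxA => /eqP ->; eexists.
(* The equation [A G A = A] can be read from either side: here the rows of [1 - A G] annihilate [A],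
   so their adjoints lie in the right null space of [adjmx A]. *)
have GA : (1%:M - A *m G) *m A = 0 by rewrite mulmxBl mul1mx AGA subrr.
suff xe i : row i (1%:M - A *m G) *m x = 0.
  apply/colP => i; have /matrixP/(_ 0 0) := xe i.
  by rewrite rowE -mulmxA -rowE !mxE.
rewrite -[row i _]adjmxK; apply/inner_r_eq0/xA.
by rewrite /null_r /= -adjmxM rowE -mulmxA GA mulmx0 adjmx0.
Qed.

End Quaternions.

Theorem lemma3p13 (R : realType) (m n : nat) (A : 'M[quat R]_(m, n)) :
  (orth_l (orth_l (null_l A)) = null_l A /\
   orth_r (orth_r (null_r A)) = null_r A) /\
  (orth_l (orth_l (range_l A)) = range_l A /\
   orth_r (orth_r (range_r A)) = range_r A) /\
  null_l A = orth_l (range_l (adjmx A)) /\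
  null_r A = orth_r (range_r (adjmx A)).
Proof.
(* Writing null spaces as complements reduces (a) to the triple complement law and makes (c) and (d)
   trivial identities. *)
rewrite null_l_orth null_r_orth orth_lK3 orth_rK3.
by rewrite range_l_orthK range_r_orthK.
Qed.
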